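(* Let $A$ be a finite alphabet, $\varphi(P_1,\ldots,P_\ell)$ an MSO sentence over $A$ with monadic predicate symbols $P_1,\ldots,P_\ell$, and $\mathbf{P}_1,\ldots,\mathbf{P}_\ell\subseteq\mathbb{N}$ uniform monadic predicates such that the language $L_{\varphi,\mathbf{P}_1,\ldots,\mathbf{P}_\ell}\subseteq A^*$ is regular. Then there exist regular uniform monadic predicates $\mathbf{Q}_1,\ldots,\mathbf{Q}_\ell\subseteq\mathbb{N}$ such that $L_{\varphi,\mathbf{P}_1,\ldots,\mathbf{P}_\ell} = L_{\varphi,\mathbf{Q}_1,\ldots,\mathbf{Q}_\ell}$.
   Context: Formulae are interpreted over finite words $u = u_0\cdots u_{n-1}$ with positions $0,\ldots,n-1$. MSO formulae are built from $\mathbf{a}(x)$ ($a\in A$), $x\le y$, $P(x)$, Boolean connectives, and first-order and monadic second-order quantification over positions. A uniform monadic predicate is a set $\mathbf{P}\subseteq\mathbb{N}$; on a word of length $n$, $P(x)$ holds iff $x\in\mathbf{P}$ (i.e. $x \in \mathbf{P}\cap\{0,\ldots,n-1\}$). $L_{\varphi,\mathbf{P}_1,\ldots,\mathbf{P}_\ell} = \{u\in A^*\mid u,\mathbf{P}_1,\ldots,\mathbf{P}_\ell\models\varphi\}$. A uniform predicate $\mathbf{Q}\subseteq\mathbb{N}$ is regular if it is ultimately periodic (equivalently, a Boolean combination of singletons $\{c\}$ and residue classes $\{x\mid x\equiv r\bmod q\}$). *)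

(* Defs.v *)
(* MathComp; sets of naturals and of words are those of mathcomp-classical. *)
From mathcomp Require Import all_boot.
From mathcomp Require Import boolp classical_sets.

Set Implicit Arguments.
Unset Strict Implicit.
Unset Printing Implicit Defensive.

Local Open Scope classical_set_scope.

(* MSO formulae over the alphabet [A] with [l] monadic predicate symbols, in
   well-scoped de Bruijn form: the free first-order variables of a
   [formula A l m k] are indexed by ['I_m] and its free set variables by ['I_k].
   A quantifier binds index 0 and shifts the outer variables of its sort by one. *)
Inductive formula (A : Type) (l : nat) : nat -> nat -> Type :=
| FLetter m k (a : A) (x : 'I_m) : formula A l m k
| FLe m k (x y : 'I_m) : formula A l m k
| FPred m k (i : 'I_l) (x : 'I_m) : formula A l m k
| FMem m k (X : 'I_k) (x : 'I_m) : formula A l m k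
| FNot m k (f : formula A l m k) : formula A l m k
| FAnd m k (f g : formula A l m k) : formula A l m k
| FOr m k (f g : formula A l m k) : formula A l m k
| FEx1 m k (f : formula A l m.+1 k) : formula A l m k
| FAll1 m k (f : formula A l m.+1 k) : formula A l m k
| FEx2 m k (f : formula A l m k.+1) : formula A l m k
| FAll2 m k (f : formula A l m k.+1) : formula A l m k.

Arguments FLetter {A l m k}.
Arguments FLe {A l m k}.
Arguments FPred {A l m k}.
Arguments FMem {A l m k}.

Definition sentence (A : Type) (l : nat) : Type := formula A l 0 0.

Definition extend (T : Type) (m : nat) (t : T) (v : 'I_m -> T) : 'I_m.+1 -> T :=
  fun i => oapp v t (unlift ord0 i).

Definition no_var (T : Type) : 'I_0 -> T :=
  fun i => False_rect T (notF (ltn_ord i)).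

Fixpoint sat (A : Type) (l n : nat) (u : n.-tuple A) (P : 'I_l -> set nat)
    (m k : nat) (f : formula A l m k) :
    ('I_m -> 'I_n) -> ('I_k -> {set 'I_n}) -> Prop :=
  match f in formula _ _ m k
    return ('I_m -> 'I_n) -> ('I_k -> {set 'I_n}) -> Prop with
  | FLetter _ _ a x => fun v _ => tnth u (v x) = a
  | FLe _ _ x y => fun v _ => v x <= v y
  | FPred _ _ i x => fun v _ => P i (val (v x))
  | FMem _ _ X x => fun v V => v x \in V X
  | FNot _ _ g => fun v V => ~ sat u P g v V
  | FAnd _ _ g h => fun v V => sat u P g v V /\ sat u P h v V
  | FOr _ _ g h => fun v V => sat u P g v V \/ sat u P h v V
  | FEx1 _ _ g => fun v V => exists x : 'I_n, sat u P g (extend x v) V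
  | FAll1 _ _ g => fun v V => forall x : 'I_n, sat u P g (extend x v) V
  | FEx2 _ _ g => fun v V => exists X : {set 'I_n}, sat u P g v (extend X V)
  | FAll2 _ _ g => fun v V => forall X : {set 'I_n}, sat u P g v (extend X V)
  end.

Definition language (A : Type) (l : nat) (phi : sentence A l)
    (P : 'I_l -> set nat) : set (seq A) :=
  [set u | sat (in_tuple u) P phi (@no_var 'I_(size u))
             (@no_var {set 'I_(size u)})].

Record dfa (A : Type) : Type := Dfa {
  dfa_state : finType;
  dfa_init : dfa_state;
  dfa_step : dfa_state -> A -> dfa_state;
  dfa_final : {set dfa_state}
}.

Definition dfa_language (A : Type) (M : dfa A) : set (seq A) :=
  [set u | foldl (@dfa_step A M) (dfa_init M) u \in dfa_final M].

Definition regular_language (A : finType) (L : set (seq A)) : Prop :=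
  exists M : dfa A, L = dfa_language M.

(* Ultimate periodicity, with threshold [t] and period [q]. *)
Definition regular_predicate (Q : set nat) : Prop :=
  exists t q : nat, 0 < q /\ forall x : nat, t <= x -> (Q (x + q) <-> Q x).

(* Main.v *)
(** By Büchi's theorem on finite words, the words over the alphabet [2^l] that
    are the length-n prefix of some tuple [Q] of predicates for which [phi]
    defines, on words of length n, the given regular language, form a regular
    language [K].  All prefixes of the infinite word [P] are in [K].  The run on
    [P] of an automaton for [K] repeats a state; looping forever between the two
    occurrences gives an ultimately periodic word with all its prefixes in [K]. *)
Require Import Defs.
From mathcomp Require Import all_boot.
From mathcomp Require Import boolp classical_sets.

Set Implicit Arguments.
Unset Strict Implicit.
Unset Printing Implicit Defensive.

Local Open Scope classical_set_scope.

(** * Closure properties and basic examples of regular languages *)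

Lemma regular_languageI (S : finType) (L1 L2 : set (seq S)) :
  regular_language L1 -> regular_language L2 -> regular_language (L1 `&` L2).
Proof.
move=> [M1 ->] [M2 ->].
exists (Dfa (dfa_init M1, dfa_init M2)
  (fun s c => (dfa_step s.1 c, dfa_step s.2 c))
  [set s | (s.1 \in dfa_final M1) && (s.2 \in dfa_final M2)]).
apply/predeqP => w; rewrite /dfa_language /=.
elim: w (dfa_init M1) (dfa_init M2) => [|c w IHw] s1 s2 /=; last exact: IHw.
by rewrite inE /=; split=> /andP.
Qed.

Lemma regular_languageC (S : finType) (L : set (seq S)) :
  regular_language L -> regular_language (~` L).
Proof.
move=> [M ->]; exists (Dfa (dfa_init M) (@dfa_step _ M) (~: dfa_final M)).
by apply/predeqP => w; rewrite /dfa_language /= inE; split=> /negP.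
Qed.

Lemma regular_languageU (S : finType) (L1 L2 : set (seq S)) :
  regular_language L1 -> regular_language L2 -> regular_language (L1 `|` L2).
Proof.
move=> r1 r2; rewrite -[_ `|` _]setCK setCU.
by apply/regular_languageC/regular_languageI; apply: regular_languageC.
Qed.

Lemma regular_language_preimage_map (S T : finType) (h : S -> T)
    (L : set (seq T)) :
  regular_language L -> regular_language [set w | L (map h w)].
Proof.
move=> [M ->].
exists (Dfa (dfa_init M) (fun s c => dfa_step s (h c)) (dfa_final M)).
apply/predeqP => w; rewrite /dfa_language /=.
by elim: w (dfa_init M) => [|c w IHw] s //=.
Qed.

(** Subset construction: the automaton guesses the second track letter by letter and keeps the set
    of all states that some guess reaches. *)
Lemma regular_language_zip_proj (S T : finType) (L : set (seq (S * T))) :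
  regular_language L ->
  regular_language [set w | exists t : seq T, size t = size w /\ L (zip w t)].
Proof.
move=> [M ->].
pose step (X : {set dfa_state M}) c :=
  [set dfa_step s (c, t) | s in X, t in [set: T]]%SET.
have stepP w X q : q \in foldl step X w <-> exists2 s, s \in X &
    exists t, size t = size w /\ foldl (@dfa_step _ M) s (zip w t) = q.
  elim: w X => [|c w IHw] X /=.
    split=> [qX|[s sX [t [/size0nil -> /= <-]]] //].
    by exists q => //; exists [::].
  rewrite IHw; split.
    move=> [_ /imset2P[s t sX _ ->] [ts [szt <-]]].
    by exists s => //; exists (t :: ts); rewrite /= szt.
  move=> [s sX [[|t ts] [] //= [szt] <-]].
  exists (dfa_step s (c, t)); last by exists ts.
  by apply/imset2P; exists s t; rewrite ?inE.
exists (Dfa [set dfa_init M]%SET step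
  [set X : {set dfa_state M} | X :&: dfa_final M != finset.set0]%SET).
apply/predeqP => w; rewrite /dfa_language /= inE; split.
  move=> [t [szt tF]]; apply/set0Pn.
  exists (foldl (@dfa_step _ M) (dfa_init M) (zip w t)).
  rewrite inE tF andbT; apply/stepP.
  by exists (dfa_init M); [rewrite inE | exists t].
move=> /set0Pn[q]; rewrite inE => /andP[/stepP[s]].
by rewrite inE => /eqP-> [t [szt <-]] ?; exists t.
Qed.

Lemma regular_language_has (S : finType) (p : pred S) :
  regular_language [set w | has p w].
Proof.
exists (Dfa false (fun b c => b || p c) [set true]%SET).
apply/predeqP => w; rewrite /dfa_language /= inE eqb_id.
rewrite -[has p w]orFb; elim: w false => [|c w IHw] b /=; first by rewrite orbF.
by rewrite orbA IHw.
Qed.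

Lemma regular_language_count1 (S : finType) (p : pred S) :
  regular_language [set w | count p w = 1].
Proof.
(* The state counts up to 2: [None] stands for at least 2. *)
exists (Dfa (Some false)
  (fun s c => if p c then if s is Some false then Some true else None else s)
  [set Some true]%SET).
apply/predeqP => w; rewrite /dfa_language /= inE.
set step := fun _ _ => _.
have stepN v : foldl step None v = None.
  by elim: v => //= c v IHv; rewrite /step; case: (p c).
have stepT v : (foldl step (Some true) v == Some true) = (count p v == 0).
  elim: v => //= c v IHv; rewrite [step _ c]/step.
  by case: (p c); rewrite ?stepN.
suff -> : (foldl step (Some false) w == Some true) = (count p w == 1).
  by split=> /eqP.
elim: w => //= c w IHw; rewrite [step _ c]/step.
by case: (p c); rewrite ?stepT.
Qed.

Lemma regular_language_find_leq (S : finType) (p q : pred S) :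
  regular_language [set w | find p w <= find q w].
Proof.
(* [None] means undecided, i.e. neither [p] nor [q] has occurred yet. *)
exists (Dfa None
  (fun s c => if s is None then
     if p c then Some true else if q c then Some false else None else s)
  (* [None] accepts: if neither [p] nor [q] occurs, both [find]s return the size of the word. *)
  (~: [set Some false])%SET).
apply/predeqP => w; rewrite /dfa_language /= !inE.
set step := fun _ _ => _.
have stepS b v : foldl step (Some b) v = Some b by elim: v.
suff -> : (foldl step None w != Some false) = (find p w <= find q w) by [].
elim: w => //= c w IHw.
by case: (p c); case: (q c); rewrite ?stepS.
Qed.

(** * Words with predicates and valuations as words over a product alphabet *)

Lemma extend_map (T U : Type) (h : T -> U) m (t : T) (v : 'I_m -> T) j :
  h (extend t v j) = extend (h t) (fun i => h (v i)) j.
Proof. by rewrite /extend; case: (unlift _ _). Qed.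

Lemma eq_extend (T : Type) m (t : T) (v v' : 'I_m -> T) :
  v =1 v' -> extend t v =1 extend t v'.
Proof. by move=> vv' j; rewrite /extend; case: (unlift _ _) => /=. Qed.

Section Encoding.
Variables (A : finType) (l : nat).

(* One track per letter, predicate symbol, first-order variable (marking its
   single position) and set variable. *)
Definition track (m k : nat) : finType :=
  (A * {ffun 'I_l -> bool} * {ffun 'I_m -> bool} * {ffun 'I_k -> bool})%type.

Definition encode n (u : n.-tuple A) (P : 'I_l -> set nat) m k
    (v : 'I_m -> 'I_n) (V : 'I_k -> {set 'I_n}) : seq (track m k) :=
  [seq (tnth u i, [ffun j => `[< P j (val i) >]],
        [ffun j => v j == i], [ffun X => i \in V X]) | i <- enum 'I_n].

Definition add_mark m k (c : track m k * bool) : track m.+1 k :=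
  (c.1.1.1, [ffun j => extend c.2 c.1.1.2 j], c.1.2).

Definition add_member m k (c : track m k * bool) : track m k.+1 :=
  (c.1.1, [ffun X => extend c.2 c.1.2 X]).

Lemma size_encode n (u : n.-tuple A) P m k (v : 'I_m -> 'I_n)
    (V : 'I_k -> {set 'I_n}) : size (encode u P v V) = n.
Proof. by rewrite size_map size_enum_ord. Qed.

Lemma encode_extend1 n (u : n.-tuple A) P m k (v : 'I_m -> 'I_n)
    (V : 'I_k -> {set 'I_n}) (x : 'I_n) :
  encode u P (extend x v) V =
  map (@add_mark m k) (zip (encode u P v V) [seq x == i | i <- enum 'I_n]).
Proof.
rewrite zip_map -map_comp; apply: eq_map => i /=; congr (_, _, _).
apply/ffunP => j; rewrite !ffunE (extend_map (fun y => y == i)).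
by apply: eq_extend => y; rewrite ffunE.
Qed.

Lemma encode_extend2 n (u : n.-tuple A) P m k (v : 'I_m -> 'I_n)
    (V : 'I_k -> {set 'I_n}) (X : {set 'I_n}) :
  encode u P v (extend X V) =
  map (@add_member m k) (zip (encode u P v V) [seq i \in X | i <- enum 'I_n]).
Proof.
rewrite zip_map -map_comp; apply: eq_map => i /=; congr (_, _).
apply/ffunP => j; rewrite !ffunE (extend_map (fun Y : {set 'I_n} => i \in Y)).
by apply: eq_extend => y; rewrite ffunE.
Qed.

(** Turns a track guessed by projection into a value for a quantified variable. *)
Lemma bitseq_of_set n (t : seq bool) : size t = n ->
  exists X : {set 'I_n}, t = [seq i \in X | i <- enum 'I_n].
Proof.
move=> szt; exists [set i : 'I_n | nth false t i]%SET.
apply: (@eq_from_nth _ false) => [|i]; first by rewrite size_map size_enum_ord.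
rewrite szt => lt_in.
rewrite (nth_map (Ordinal lt_in)) ?size_enum_ord // inE.
by rewrite nth_enum_ord.
Qed.

Lemma count_mem_enum n (X : {set 'I_n}) :
  count id [seq i \in X | i <- enum 'I_n] = #|X|.
Proof. by rewrite count_map -size_filter cardE enumT. Qed.

(** Track [x] is marked at position [v x] only, so searching for a marked letter inspects exactly
    that position. This handles every atom except the order. *)
Lemma has_encode n (u : n.-tuple A) P m k (v : 'I_m -> 'I_n)
    (V : 'I_k -> {set 'I_n}) x (p : pred (track m k)) :
  has (fun c : track m k => c.1.2 x && p c) (encode u P v V) =
  p (tnth u (v x), [ffun j => `[< P j (val (v x)) >]],
        [ffun j => v j == v x], [ffun X => v x \in V X]).
Proof.
rewrite has_map; apply/hasP/idP => [[i _ /=]|px].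
  by rewrite ffunE => /andP[/eqP<-].
by exists (v x); rewrite ?mem_enum //= ffunE eqxx.
Qed.

Lemma find_mark_encode n (u : n.-tuple A) P m k (v : 'I_m -> 'I_n)
    (V : 'I_k -> {set 'I_n}) x :
  find (fun c : track m k => c.1.2 x) (encode u P v V) = v x.
Proof.
rewrite find_map -[RHS](index_enum_ord (v x)) /index; apply: eq_find => i /=.
by rewrite ffunE eq_sym.
Qed.

(** * Büchi's theorem, by induction on formulae *)

(** One [L] serves all [n] and all [P], since the predicates are read from the word. Nothing is
    asked of [L] outside encodings, so a plain complement handles negation. *)
Definition mso_regular m k (f : formula A l m k) : Prop :=
  exists2 L : set (seq (track m k)), regular_language L &
    forall n (u : n.-tuple A) P v V, sat u P f v V <-> L (encode u P v V).

Lemma mso_regular_not m k (f : formula A l m k) :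
  mso_regular f -> mso_regular (FNot f).
Proof.
move=> [L rL LP]; exists (~` L); first exact: regular_languageC.
by move=> n u P v V /=; rewrite LP.
Qed.

(** The guessed track must carry exactly one mark, so that it denotes a position; the words accepted
    for [f] are not themselves known to satisfy this. *)
Lemma mso_regular_ex1 m k (f : formula A l m.+1 k) :
  mso_regular f -> mso_regular (FEx1 f).
Proof.
move=> [L rL LP].
exists [set w | exists t, size t = size w /\
  ([set z | count snd z = 1] `&` [set z | L (map (@add_mark m k) z)]) (zip w t)].
  apply/regular_language_zip_proj/regular_languageI.
    exact: regular_language_count1.
  exact: regular_language_preimage_map.
move=> n u P v V /=; rewrite size_encode.
have count_snd t : size t = n -> count snd (zip (encode u P v V) t) = count id t.
  move=> szt; rewrite -[t in RHS](@unzip2_zip _ _ (encode u P v V)) ?count_map //.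
  by rewrite size_encode szt.
split=> [[x /LP]|[t [szt []]]].
  rewrite encode_extend1 => Lx; exists [seq x == i | i <- enum 'I_n].
  have szx : size [seq x == i | i <- enum 'I_n] = n.
    by rewrite size_map size_enum_ord.
  split=> //; split=> //; rewrite count_snd // -(cards1 x) -count_mem_enum.
  by congr count; apply: eq_map => i; rewrite inE eq_sym.
rewrite count_snd //; have [X ->] := bitseq_of_set szt.
rewrite count_mem_enum => /eqP/cards1P[x ->] Lx.
exists x; apply/LP; rewrite encode_extend1; congr (L (map _ (zip _ _))): Lx.
by apply: eq_map => i; rewrite inE eq_sym.
Qed.

Lemma mso_regular_ex2 m k (f : formula A l m k.+1) :
  mso_regular f -> mso_regular (FEx2 f).
Proof.
move=> [L rL LP].
exists [set w | exists t, size t = size w /\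
  [set z | L (map (@add_member m k) z)] (zip w t)].
  exact/regular_language_zip_proj/regular_language_preimage_map.
move=> n u P v V /=; rewrite size_encode; split=> [[X /LP]|[t [szt]]].
  rewrite encode_extend2 => LX; exists [seq i \in X | i <- enum 'I_n].
  by rewrite size_map size_enum_ord.
have [X ->] := bitseq_of_set szt.
by rewrite -encode_extend2 => /LP LX; exists X.
Qed.

Lemma mso_regular_equiv m k (f g : formula A l m k) :
  (forall n (u : n.-tuple A) P v V, sat u P f v V <-> sat u P g v V) ->
  mso_regular f -> mso_regular g.
Proof.
by move=> fg [L rL LP]; exists L => // n u P v V; rewrite -fg.
Qed.

Lemma mso_regularP m k (f : formula A l m k) : mso_regular f.
Proof.
elim: f => {m k}.
- move=> m k a x.
  exists [set w | has (fun c : track m k => c.1.2 x && (c.1.1.1 == a)) w].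
    exact: regular_language_has.
  move=> n u P v V /=; rewrite (has_encode _ _ _ _ _ (fun c => c.1.1.1 == a)) /=.
  by split=> /eqP.
- move=> m k x y.
  exists [set w | find (fun c : track m k => c.1.2 x) w <=
                  find (fun c : track m k => c.1.2 y) w].
    exact: regular_language_find_leq.
  by move=> n u P v V /=; rewrite !find_mark_encode.
- move=> m k i x.
  exists [set w | has (fun c : track m k => c.1.2 x && c.1.1.2 i) w].
    exact: regular_language_has.
  move=> n u P v V /=; rewrite (has_encode _ _ _ _ _ (fun c => c.1.1.2 i)) /=.
  by rewrite ffunE; split=> /asboolP.
- move=> m k X x.
  exists [set w | has (fun c : track m k => c.1.2 x && c.2 X) w].
    exact: regular_language_has.
  move=> n u P v V /=; rewrite (has_encode _ _ _ _ _ (fun c => c.2 X)) /=.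
  by rewrite ffunE.
- by move=> m k f; apply: mso_regular_not.
- move=> m k f [L rL LP] g [L' rL' LP']; exists (L `&` L').
    exact: regular_languageI.
  by move=> n u P v V /=; rewrite LP LP'.
- move=> m k f [L rL LP] g [L' rL' LP']; exists (L `|` L').
    exact: regular_languageU.
  by move=> n u P v V /=; rewrite LP LP'.
- by move=> m k f; apply: mso_regular_ex1.
(* Universal quantifiers reduce to existential ones by classical duality. *)
- move=> m k f rf; apply: (@mso_regular_equiv _ _ (FNot (FEx1 (FNot f)))).
    move=> n u P v V /=; split=> [nex x|all [x]]; last by apply.
    by apply: contrapT => nf; apply: nex; exists x.
  exact/mso_regular_not/mso_regular_ex1/mso_regular_not.
- by move=> m k f; apply: mso_regular_ex2.
- move=> m k f rf; apply: (@mso_regular_equiv _ _ (FNot (FEx2 (FNot f)))).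
    move=> n u P v V /=; split=> [nex x|all [x]]; last by apply.
    by apply: contrapT => nf; apply: nex; exists x.
  exact/mso_regular_not/mso_regular_ex2/mso_regular_not.
Qed.

(** * The regular language of correct predicate prefixes *)

Definition pred_prefix (P : 'I_l -> set nat) (n : nat) :
    seq {ffun 'I_l -> bool} :=
  [seq [ffun j => `[< P j x >]] | x <- iota 0 n].

(** The letter of [A] comes second in the pair because projection erases the second track. The two
    constant functions are the only ones on the empty type ['I_0]. *)
Definition sentence_track (c : {ffun 'I_l -> bool} * A) : track 0 0 :=
  (c.2, c.1, [ffun => false], [ffun => false]).

Lemma encode_sentence (u : seq A) P (v : 'I_0 -> 'I_(size u))
    (V : 'I_0 -> {set 'I_(size u)}) :
  encode (in_tuple u) P v V =
  map sentence_track (zip (pred_prefix P (size u)) u).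
Proof.
rewrite -[u in zip _ u]/(tval (in_tuple u)) -[tval _]map_tnth_enum.
rewrite /pred_prefix -val_enum_ord -map_comp zip_map -map_comp.
apply: eq_map => i /=.
by congr (_, _, _, _); apply/ffunP => -[].
Qed.

(** A prefix is wrong if some word of the same length lies in exactly one of the language of [phi]
    and [R]. Projecting this symmetric difference along the word track gives the wrong prefixes, and
    [K] is the complement. It is chosen before [P], so it can test any other tuple of predicates. *)
Lemma regular_correct_prefixes (phi : sentence A l) (R : set (seq A)) :
  regular_language R ->
  exists2 K : set (seq {ffun 'I_l -> bool}), regular_language K &
    forall P, (forall n, K (pred_prefix P n)) <-> language phi P = R.
Proof.
move=> rR; have [L rL LP] := mso_regularP phi.
pose L1 : set (seq ({ffun 'I_l -> bool} * A)) := [set z | L (map sentence_track z)].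
pose R1 : set (seq ({ffun 'I_l -> bool} * A)) := [set z | R (map snd z)].
have rL1 : regular_language L1 by exact: regular_language_preimage_map.
have rR1 : regular_language R1 by exact: regular_language_preimage_map.
exists (~` [set w | exists u, size u = size w /\
  ((L1 `&` ~` R1) `|` (~` L1 `&` R1)) (zip w u)]).
  apply/regular_languageC/regular_language_zip_proj/regular_languageU;
    by apply: regular_languageI => //; apply: regular_languageC.
move=> P.
have sz n : size (pred_prefix P n) = n by rewrite size_map size_iota.
have L1E u : L1 (zip (pred_prefix P (size u)) u) <-> language phi P u.
  by rewrite /language /= LP encode_sentence.
have R1E u : R1 (zip (pred_prefix P (size u)) u) <-> R u.
  by rewrite /R1 /= [map _ _]unzip2_zip ?sz.
split=> [KP|PR n [u []]].
  apply/predeqP => u; apply: contrapT => neq.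
  apply: (KP (size u)); exists u; rewrite sz; split=> //.
  move: neq; rewrite -L1E -R1E /=.
  have [|] := pselect (L1 (zip (pred_prefix P (size u)) u)) => lu;
    have [|] := pselect (R1 (zip (pred_prefix P (size u)) u)) => ru; tauto.
by rewrite sz => <- /= []; rewrite L1E R1E PR; tauto.
Qed.

End Encoding.

(** * Pumping the run into an ultimately periodic one *)

Lemma repeated_value (S : finType) (s : nat -> S) :
  exists i j : nat, i < j /\ s i = s j.
Proof.
apply: contrapT => nrep.
(* Pigeonhole on one more index than [S] has elements. *)
have inj_s : injective (fun i : 'I_#|S|.+1 => s i).
  move=> i j sij; apply/val_inj; case: (ltngtP i j) => // lt; case: nrep.
    by exists i, j.
  by exists j, i.
by have := leq_card _ inj_s; rewrite card_ord ltnn.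
Qed.

(* The walk [0, 1, ..., j - 1, i, ..., j - 1, i, ...]. *)
Definition lasso (i j n : nat) : nat :=
  iter n (fun x => if x.+1 == j then i else x.+1) 0.

Lemma lasso_small i j n : n < j -> lasso i j n = n.
Proof.
elim: n => //= n IHn ltnj; rewrite /lasso /= -/(lasso i j n) IHn ?(ltnW ltnj) //.
by rewrite ltn_eqF.
Qed.

Lemma lasso_period i j n : i < j -> i <= n ->
  lasso i j (n + (j - i)) = lasso i j n.
Proof.
move=> ltij lein.
have -> : n + (j - i) = (n - i) + j by rewrite addnBA 1?ltnW // addnBAC.
(* Both walks make [n - i] further steps, one after [j] steps and the other after [i]; it remains to
   see that both are then at [i]. *)
rewrite -[in RHS](subnK lein) /lasso !iterD; congr iter.
rewrite -/(lasso i j j) -/(lasso i j i) (lasso_small _ ltij).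
case: j ltij => // j _; rewrite /lasso /= -/(lasso i j.+1 j).
by rewrite lasso_small // eqxx.
Qed.

Lemma regular_predicate_lasso (P : set nat) i j : i < j ->
  regular_predicate [set x | P (lasso i j x)].
Proof.
move=> ltij; exists i, (j - i); split; first by rewrite subn_gt0.
by move=> x leix; rewrite /= lasso_period.
Qed.

Theorem mainTheorem6 (A : finType) (l : nat) (phi : sentence A l)
    (P : 'I_l -> set nat) :
  regular_language (language phi P) ->
  exists Q : 'I_l -> set nat,
    (forall i : 'I_l, regular_predicate (Q i)) /\
    language phi P = language phi Q.
Proof.
move=> /(regular_correct_prefixes phi)[_ [M ->] KP].
pose run Q n := foldl (@dfa_step _ M) (dfa_init M) (pred_prefix Q n).
have runS Q n : run Q n.+1 = dfa_step (run Q n) [ffun j => `[< Q j n >]].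
  by rewrite /run /pred_prefix -addn1 iotaD map_cat foldl_cat.
have [i [j [ltij rij]]] := repeated_value (run P).
pose Q k := [set x | P k (lasso i j x)].
exists Q; split=> [k|]; first exact: regular_predicate_lasso.
(* At position [n], [Q] shows the letter of [P] at [lasso i j n], so the two runs advance together.
   When the walk jumps from [j] back to [i], the state is unchanged by [rij]. *)
have runQ n : run Q n = run P (lasso i j n).
  elim: n => // n IHn; rewrite runS IHn /lasso /= -/(lasso i j n).
  rewrite -runS; case: eqP => // ->.
  by rewrite rij.
(* [KP] is used twice: for [Q] it asks that every prefix be accepted, and for [P], with the trivial
   equality of languages, it provides acceptance at length [lasso i j n]. *)
apply/esym/KP => n; rewrite /dfa_language /= -/(run Q n) runQ.
by have /KP := erefl (language phi P); apply.
Qed.
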